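(* Let $\mathcal{M}=(G,In,Out,L)$ be a linear compartmental model such that either $G$ is strongly input-output connected and $|Out|=1$, or $G$ is strongly connected and $|In|=1$. If $|L|>|In\cup Out|$, then $\mathcal{M}$ is unidentifiable.
   Context: A linear compartmental model $(G,In,Out,Leak)$ consists of a finite directed graph $G=(V,E)$ (no self-loops, no repeated edges) and subsets $In,Out,Leak\subseteq V$ (input, output and leak compartments; $In,Out$ nonempty). Each edge $j\to i$ carries an independent parameter $a_{ij}$ and each $i\in Leak$ an independent parameter $a_{0i}$. The compartmental matrix $A$ has $A_{ij}=a_{ij}$ if $j\to i\in E$; $A_{ii}=-a_{0i}-\sum_{k:\,i\to k\in E}a_{ki}$ if $i\in Leak$; $A_{ii}=-\sum_{k:\,i\to k\in E}a_{ki}$ if $i\notin Leak$; all other entries $0$. The model is the system $x'=Ax+u$, $y_i=x_i$ for $i\in Out$, with $u_i\equiv 0$ for $i\notin In$. When every vertex has a directed path to every output (which holds under the hypotheses here), the input-output equation for $j\in Out$ is $\det(\partial I-A)\,y_j=\sum_{i\in In}(-1)^{i+j}\det(\partial I-A)_{ij}\,u_i$, where $\partial=d/dt$ and $(\cdot)_{ij}$ means delete row $i$ and column $j$. The coefficient map $c:\mathbb{R}^{|E|+|Leak|}\to\mathbb{R}^k$ collects all nonzero, nonmonic coefficients (polynomials in the parameters) of these equations over all $j\in Out$. A cycle is a closed directed path with no repeated vertices. $G$ is strongly input-output connected if it is connected (as an undirected graph) and every edge lies in a cycle or in a directed path from an input vertex to an output vertex. A model is unidentifiable if $c$ is infinite-to-one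 (generically). *)

(* Defs.v *)
From mathcomp Require Import classical_sets cardinality reals.
From mathcomp Require Import all_boot all_order all_algebra.
From mathcomp Require Import mpoly.

Set Implicit Arguments.
Unset Strict Implicit.
Unset Printing Implicit Defensive.

Import GRing.Theory.
Local Open Scope ring_scope.

(* The vertices are numbered, as the signs (-1)^(i+j) of the input-output     *)
(* equations refer to a numbering.                                            *)
Record model (n : nat) := Model {
  edge : rel 'I_n;  (* edge j i means j -> i *)
  input : {set 'I_n};
  output : {set 'I_n};
  leak : {set 'I_n};
  edge_irr : irreflexive edge;
  input_neq0 : input != set0;
  output_neq0 : output != set0 }.

Section Graph.
Variables (n : nat) (M : model n).

Definition strongly_connected := forall u v : 'I_n, connect (edge M) u v.

Definition weakly_connected :=
  forall u v : 'I_n, connect [rel x y | edge M x y || edge M y x] u v.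

Definition in_cycle (u v : 'I_n) :=
  exists c : seq 'I_n, [/\ ucycle (edge M) c, u \in c & next c u = v].

Definition in_io_path (u v : 'I_n) :=
  exists (x : 'I_n) (p : seq 'I_n),
    [/\ x \in input M, path (edge M) x p, last x p \in output M
      & infix [:: u; v] (x :: p)].

Definition strongly_io_connected :=
  weakly_connected /\
  forall u v : 'I_n, edge M u v -> in_cycle u v \/ in_io_path u v.

End Graph.

Section CoefficientMap.
Variables (R : realType) (n : nat) (M : model n).

(* inl (j, i) stands for a_ij (j -> i an edge), inr i for a_0i (i a leak).     *)
Definition param : finType :=
  ({e : 'I_n * 'I_n | edge M e.1 e.2} + {i : 'I_n | i \in leak M})%type.

Definition nparam : nat := #|{: param}|.

Definition param_var (p : param) : {mpoly R[nparam]} := 'X_(enum_rank p).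

(* a_ij, and 0 if j -> i is not an edge *)
Definition edge_var (i j : 'I_n) : {mpoly R[nparam]} :=
  if insub (j, i) is Some e then param_var (inl e) else 0.

(* a_0i, and 0 if i is not a leak *)
Definition leak_var (i : 'I_n) : {mpoly R[nparam]} :=
  if insub i is Some l then param_var (inr l) else 0.

Definition compartmental_mx : 'M[{mpoly R[nparam]}]_n :=
  \matrix_(i, j)
    if i == j then - leak_var i - \sum_(k | edge M i k) edge_var k i
    else edge_var i j.

(* Coefficients of the input-output equation                                  *)
(*   det(dI - A) y_j = sum_(i in In) (-1)^(i+j) det(dI - A)_ij u_i,           *)
(* where the polynomial variable 'X stands for the operator d = d/dt.         *)
Definition lhs_poly : {poly {mpoly R[nparam]}} := char_poly compartmental_mx.

Definition rhs_poly (i j : 'I_n) : {poly {mpoly R[nparam]}} :=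
  cofactor (char_poly_mx compartmental_mx) i j.

(* A coefficient is identically 1 exactly when it is the leading coefficient  *)
(* of a monic left-hand side or of a monic diagonal minor: all the others are *)
(* zero or homogeneous of positive degree in the parameters.                  *)
Definition nontrivial_coefs (p : {poly {mpoly R[nparam]}}) :
    seq {mpoly R[nparam]} :=
  [seq c <- p | (c != 0) && (c != 1)].

Definition io_coefs (j : 'I_n) : seq {mpoly R[nparam]} :=
  nontrivial_coefs lhs_poly ++
  flatten [seq nontrivial_coefs (rhs_poly i j) | i <- enum (input M)].

Definition coef_polys : seq {mpoly R[nparam]} :=
  flatten [seq io_coefs j | j <- enum (output M)].

Definition coef_map (t : 'rV[R]_nparam) : 'rV[R]_(size coef_polys) :=
  \row_k (coef_polys`_k).@[t 0].

(* Generically: outside a proper real algebraic subset of parameter space.    *)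
Definition unidentifiable :=
  exists f : {mpoly R[nparam]}, f != 0 /\
  forall t : 'rV[R]_nparam, f.@[t 0] != 0 ->
    infinite_set [set s | coef_map s = coef_map t]%classic.

End CoefficientMap.

(* Main.v *)
Require Import Defs.
From mathcomp Require Import classical_sets cardinality reals.
From mathcomp Require Import all_boot all_order all_algebra.
From mathcomp Require Import mpoly.

(** Diagonal conjugation gives more freedom than the missing leaks take away.

    Let A be the compartmental matrix at a parameter value t none of whose
    coordinates vanishes, and let D = diag(d) with d nonzero everywhere and
    d_i = 1 on In u Out.  Then D A D^-1 has the same characteristic polynomial
    as A, and the same (i, j) cofactors of XI - A for i in In and j in Out,
    because conjugation multiplies this cofactor by d_j / d_i
    ([char_poly_conj], [cofactor_char_poly_conj], [coef_map_conj]).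

    The matrix D A D^-1 is again a compartmental matrix of the model as soon
    as, for every vertex l without leak, its column l still sums to zero, i.e.
    (d A)_l = 0: at the vertices with a leak, the leak parameter absorbs any
    change of the column sum ([mx_val_conj]).  These conditions are linear in
    d and hold for d = (1, ..., 1).  Hence d = 1 + eps e satisfies them for
    every eps, and d has no zero entry for small eps, provided that e vanishes
    on In u Out and (e A)_l = 0 for l outside Leak.  This homogeneous
    system has n - |In u Out| unknowns and n - |Leak| equations, so
    |Leak| > |In u Out| yields some e <> 0
    ([exists_supported_kernel_vector]).

    Finally, distinct values of eps give distinct parameters: the edge
    parameters a_ij d_i / d_j determine the ratios of d along the edges, hence
    all of d, since the graph is connected and d is 1 at an input
    ([conj_param_inj]).  So the fibre of the coefficient map through t is
    infinite. *)

Set Implicit Arguments.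
Unset Strict Implicit.
Unset Printing Implicit Defensive.

Import Order.TTheory GRing.Theory Num.Theory.
Local Open Scope ring_scope.

(** * Diagonal conjugation *)

Lemma det_diag_scale (R : comPzRingType) n (d e : 'I_n -> R) (A : 'M[R]_n) :
  \det (\matrix_(k, l) (d k * A k l * e l)) =
  (\prod_k d k) * (\prod_k e k) * \det A.
Proof.
have -> : \matrix_(k, l) (d k * A k l * e l) =
          diag_mx (\row_k d k) *m A *m diag_mx (\row_k e k).
  by rewrite mul_diag_mx mul_mx_diag; apply/matrixP=> k l; rewrite !mxE.
rewrite !det_mulmx !det_diag mulrAC.
by congr (_ * _ * _); apply: eq_bigr => k _; rewrite mxE.
Qed.

(** The factors [d i] and [e j] on the left make up for the row and the column
    that the minor lacks; this avoids dividing, as needed over {poly F}. *)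
Lemma cofactor_diag_scale (R : comPzRingType) n (d e : 'I_n -> R)
    (A : 'M[R]_n) i j :
  d i * e j * cofactor (\matrix_(k, l) (d k * A k l * e l)) i j =
  (\prod_k d k) * (\prod_k e k) * cofactor A i j.
Proof.
rewrite /cofactor.
have -> : row' i (col' j (\matrix_(k, l) (d k * A k l * e l))) =
    \matrix_(k, l) (d (lift i k) * row' i (col' j A) k l * e (lift j l)).
  by apply/matrixP=> k l; rewrite !mxE.
rewrite det_diag_scale (bigD1_ord i) //= (bigD1_ord j (F := e)) //=.
by rewrite mulrCA [RHS]mulrCA; congr (_ * _); rewrite mulrA mulrACA.
Qed.

Section Conjugation.
Variables (F : fieldType) (n : nat) (d : 'I_n -> F) (A B : 'M[F]_n).
Hypothesis d_neq0 : forall i, d i != 0.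
Hypothesis conjAB : forall i j, B i j = d i * A i j / d j.

Let char_poly_mx_conj : char_poly_mx B =
  \matrix_(k, l) ((d k)%:P * char_poly_mx A k l * (d l)^-1%:P).
Proof.
apply/matrixP=> k l; rewrite !mxE conjAB mulrBr mulrBl !polyCM.
congr (_ - _); case: eqVneq => [->|_]; last by rewrite !mulr0n mulr0 mul0r.
by rewrite mulr1n mulrAC -polyCM mulfV // mul1r.
Qed.

Let prod_dK : \prod_k (d k)%:P * \prod_k (d k)^-1%:P = 1.
Proof.
by rewrite -big_split big1 // => k _; rewrite /= -polyCM mulfV.
Qed.

Lemma char_poly_conj : char_poly B = char_poly A.
Proof. by rewrite /char_poly char_poly_mx_conj det_diag_scale prod_dK mul1r. Qed.

Lemma cofactor_char_poly_conj i j : d i = 1 -> d j = 1 ->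
  cofactor (char_poly_mx B) i j = cofactor (char_poly_mx A) i j.
Proof.
move=> di dj; have := cofactor_diag_scale (fun k => (d k)%:P)
  (fun k => (d k)^-1%:P) (char_poly_mx A) i j.
by rewrite -char_poly_mx_conj prod_dK di dj invr1 !mul1r.
Qed.

End Conjugation.

(** With more unknowns (the entries of e in U) than equations (the columns in
    W), the homogeneous system has a nonzero solution. *)
Lemma exists_supported_kernel_vector (F : fieldType) n (A : 'M[F]_n)
    (U W : {set 'I_n}) : (#|W| < #|U|)%N ->
  exists e : 'I_n -> F, [/\ exists i, e i != 0,
    forall i, i \notin U -> e i = 0 &
    forall l, l \in W -> \sum_i e i * A i l = 0].
Proof.
move=> ltWU.
pose B : 'M[F]_(#|U|, #|W|) := \matrix_(i, j) A (enum_val i) (enum_val j).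
have kerB : kermx B != 0.
  rewrite kermx_eq0 /row_free neq_ltn.
  by rewrite (leq_ltn_trans (rank_leq_col B) ltWU).
have [v /sub_kermxP vB0 v_neq0] := rowV0Pn kerB.
(* v extended by 0 outside U: the sum has at most one term *)
pose e i := \sum_(k | enum_val k == i) v 0 k.
have eE k : e (enum_val k) = v 0 k.
  by rewrite /e (big_pred1 k) // => k'; rewrite (inj_eq enum_val_inj).
exists e; split.
- have [k vk] := rV0Pn _ v_neq0.
  by exists (enum_val k); rewrite eE.
- move=> i iU; rewrite /e big_pred0 // => k; apply: contraNF iU => /eqP <-.
  exact: enum_valP.
- move=> l lW; transitivity ((v *m B) 0 (enum_rank_in lW l)); last first.
    by rewrite vB0 mxE.
  rewrite mxE (bigID (mem U)) /= [X in _ + X]big1 ?addr0 => [|i iU].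
    rewrite big_enum_val /=; apply: eq_bigr => k _.
    by rewrite eE mxE enum_rankK_in.
  by rewrite /e big_pred0 ?mul0r // => k; apply: contraNF iU => /eqP <-;
     exact: enum_valP.
Qed.

(** * Compartmental matrices at a parameter value *)

Section Evaluation.
Variables (R : realType) (n : nat) (M : model n).
Implicit Types t s : 'rV[R]_(nparam M).

(** The value a_ij of the parameter of the edge j -> i at t (0 without such an
    edge), the value a_0i of the leak parameter of i at t (0 without leak), and
    the compartmental matrix at t. *)
Definition edge_val t (i j : 'I_n) : R := (edge_var R M i j).@[t 0].
Definition leak_val t (i : 'I_n) : R := (leak_var R M i).@[t 0].
Definition mx_val t : 'M[R]_n := map_mx (meval (t 0)) (compartmental_mx R M).

Lemma edge_valE t i j (ji : edge M j i) :
  edge_val t i j = t 0 (enum_rank (inl (exist _ (j, i) ji) : param M)).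
Proof.
rewrite /edge_val /edge_var; case: insubP => [e _ eji|/=]; last by rewrite ji.
rewrite /param_var mevalXU; congr (t 0 (enum_rank (inl _))); exact: val_inj.
Qed.

Lemma edge_val0 t i j : ~~ edge M j i -> edge_val t i j = 0.
Proof. by move=> ji; rewrite /edge_val /edge_var insubN ?meval0. Qed.

Lemma leak_valE t i (iL : i \in leak M) :
  leak_val t i = t 0 (enum_rank (inr (exist _ i iL) : param M)).
Proof.
rewrite /leak_val /leak_var; case: insubP => [l _ li|/=]; last by rewrite iL.
rewrite /param_var mevalXU; congr (t 0 (enum_rank (inr _))); exact: val_inj.
Qed.

Lemma leak_val0 t i : i \notin leak M -> leak_val t i = 0.
Proof. by move=> iL; rewrite /leak_val /leak_var insubN ?meval0. Qed.

Lemma mx_valE t i j : mx_val t i j =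
  if i == j then - leak_val t i - \sum_k edge_val t k i else edge_val t i j.
Proof.
rewrite !mxE; case: eqP => // _; rewrite mevalB mevalN; congr (_ - _).
rewrite raddf_sum /= big_mkcond; apply: eq_bigr => k _.
by case: ifPn => // ik; rewrite edge_val0.
Qed.

Lemma edge_val_diag t i : edge_val t i i = 0.
Proof. by rewrite edge_val0 // edge_irr. Qed.

(** The coefficients of the input-output equations are invariant under
    diagonal conjugations that are trivial at the inputs and outputs. *)
Lemma coef_map_conj t s (d : 'I_n -> R) :
    (forall i, d i != 0) ->
    (forall i, i \in input M :|: output M -> d i = 1) ->
    (forall i j, mx_val s i j = d i * mx_val t i j / d j) ->
  Defs.coef_map s = Defs.coef_map t.
Proof.
move=> d_neq0 d1 conj; apply/rowP=> k; rewrite !mxE.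
have: (coef_polys R M)`_k \in coef_polys R M by exact: mem_nth.
case/flatten_mapP => j; rewrite mem_enum => jO; rewrite mem_cat.
have coefP (p : {poly {mpoly R[nparam M]}}) c : c \in nontrivial_coefs p ->
    map_poly (meval (s 0)) p = map_poly (meval (t 0)) p ->
    c.@[s 0] = c.@[t 0].
  rewrite mem_filter => /andP[_ /(nthP 0)[m _ <-]]
    /(congr1 (fun q : {poly R} => q`_m)).
  by rewrite !poly.coef_map.
case/orP => [/coefP|/flatten_mapP[i]]; first apply.
  by rewrite !map_char_poly (char_poly_conj d_neq0 conj).
rewrite mem_enum => iI /coefP; apply.
rewrite /rhs_poly -!cofactor_map_mx !map_char_poly_mx.
by apply: (cofactor_char_poly_conj d_neq0 conj); apply: d1;
   rewrite inE ?iI ?jO ?orbT.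
Qed.

(** The only candidate for a parameter value with compartmental matrix
    D A D^-1: its edge parameters are the off-diagonal entries, and its leak
    parameters are those giving the unchanged diagonal entries A_ll. *)
Definition conj_param t (d : 'I_n -> R) : 'rV[R]_(nparam M) :=
  \row_p match enum_val p with
         | inl e => d (val e).2 * edge_val t (val e).2 (val e).1 / d (val e).1
         | inr l => - mx_val t (val l) (val l)
                    - \sum_k d k * edge_val t k (val l) / d (val l)
         end.

Lemma edge_val_conj t d i j :
  edge_val (conj_param t d) i j = d i * edge_val t i j / d j.
Proof.
have [ji|ji] := boolP (edge M j i); last by rewrite !edge_val0 // mulr0 mul0r.
by rewrite edge_valE mxE enum_rankK.
Qed.

(** Without leak at l, the diagonal entry A_ll has to be minus the sum of the
    new edge parameters leaving l; this is what (d A)_l = 0 says. *)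
Lemma mx_val_conj t d : (forall i, d i != 0) ->
    (forall l, l \notin leak M -> \sum_i d i * mx_val t i l = 0) ->
  forall i j, mx_val (conj_param t d) i j = d i * mx_val t i j / d j.
Proof.
move=> d_neq0 dA0 i j; rewrite mx_valE edge_val_conj [in RHS]mx_valE.
case: eqVneq => // <-{j}; rewrite mulrAC mulfV // mul1r.
under eq_bigr do rewrite edge_val_conj.
have [iL|iL] := boolP (i \in leak M).
  rewrite leak_valE mxE enum_rankK /= opprB opprK addrAC subrr add0r.
  by rewrite mx_valE eqxx.
rewrite !leak_val0 // oppr0 !add0r -mulr_suml; congr (- _).
have := dA0 i iL; rewrite (bigD1 i) //= mx_valE eqxx leak_val0 // oppr0 add0r.
rewrite mulrN addrC => /eqP; rewrite subr_eq0 => /eqP sumE.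
rewrite (bigD1 i) //= edge_val_diag mulr0 add0r.
rewrite -[RHS](mulfK (d_neq0 i)) [_ * d i]mulrC -sumE; congr (_ / _).
by apply: eq_bigr => k ki; rewrite mx_valE (negPf ki).
Qed.

Lemma conj_param_inj t (d d' : 'I_n -> R) i0 :
    weakly_connected M -> (forall p, t 0 p != 0) ->
    (forall i, d i != 0) -> (forall i, d' i != 0) -> d i0 = d' i0 ->
  conj_param t d = conj_param t d' -> d =1 d'.
Proof.
move=> wc t_neq0 d_neq0 d'_neq0 d0 eqdd' i.
have ratio j k : edge M j k -> d k / d j = d' k / d' j.
  move=> jk; have := congr1 (fun s => edge_val s k j) eqdd'.
  rewrite !edge_val_conj => /eqP; rewrite mulrAC [eqbRHS]mulrAC.
  by rewrite (inj_eq (mulIf _)) => [/eqP//|]; rewrite edge_valE.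
have step j k : edge M j k || edge M k j -> d j = d' j -> d k = d' k.
  case/orP => /ratio + dj; rewrite dj.
    by move/mulIf; apply; rewrite invr_eq0.
  by move/mulfI => /(_ (d'_neq0 j)) /invr_inj.
have /connectP[p] := wc i0 i.
elim: p i0 d0 => [|j p IHp] k dk /= => [_ -> //|/andP[kj pj]].
exact: (IHp j (step k j kj dk)).
Qed.

End Evaluation.

(** * Infinite fibres *)

Lemma nonvanishing_line (R : realType) n (e : 'I_n -> R) :
  exists2 eps : nat -> R, injective eps & forall m i, 1 + eps m * e i != 0.
Proof.
pose b := \sum_i `|e i|.
have b_ge0 : 0 <= b by apply: sumr_ge0.
have den_gt0 m : 0 < b + m.+1%:R by rewrite ltr_wpDl // ltr0n.
(* eps m <= 1 / (b + 1) keeps |eps m * e i| below 1 *)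
exists (fun m => (b + m.+1%:R)^-1).
  by move=> m m' /invr_inj/addrI/eqP; rewrite eqr_nat => /eqP[].
move=> m i; rewrite addrC addr_eq0; apply/eqP => eE.
have le_eb : `|e i| <= b.
  by rewrite /b (bigD1 i) //= lerDl; apply: sumr_ge0.
have : `|(b + m.+1%:R)^-1 * e i| = 1 by rewrite eE normrN normr1.
rewrite normrM gtr0_norm ?invr_gt0 // mulrC => /divr1_eq eb.
by move: le_eb; rewrite eb leNgt ltrDl ltr0n.
Qed.

Lemma infinite_set_of_inj (T : Type) (A : set T) (f : nat -> T) :
  injective f -> (forall m, A (f m)) -> infinite_set A.
Proof.
move=> f_inj fA finA; apply: infinite_nat.
suff <- : (f @^-1` A)%classic = [set: nat]%classic.
  by apply: finite_preimage finA => m m' _ _ /f_inj.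
by apply/seteqP; split => m // _; apply: fA.
Qed.

Theorem theorem6p1 (R : realType) (n : nat) (M : model n)
  (hM : (strongly_io_connected M /\ #|output M| = 1%N) \/
        (strongly_connected M /\ #|input M| = 1%N))
  (hL : (#|input M :|: output M| < #|leak M|)%N) :
  unidentifiable R M.
Proof.
have wc : weakly_connected M.
  case: hM => [[[]]//|[sc _] u v]; apply: connect_sub (sc u v) => x y xy.
  by apply: connect1; rewrite /= xy.
(* off the coordinate hyperplanes *)
exists (\prod_p 'X_p); split.
  apply/eqP => /(congr1 (meval (fun=> 1))); rewrite meval0 rmorph_prod big1.
    by move/eqP; rewrite oner_eq0.
  by move=> p _; rewrite /= mevalXU.
move=> t; rewrite rmorph_prod => /prodf_neq0 t_neq0.
have {}t_neq0 p : t 0 p != 0 by have := t_neq0 p isT; rewrite /= mevalXU.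
have ltC : (#|~: leak M| < #|~: (input M :|: output M)|)%N.
  rewrite -(ltn_add2l #|leak M|) cardsC.
  by rewrite -(cardsC (input M :|: output M)) ltn_add2r.
have [e [[i1 ei1] eIO eL]] := exists_supported_kernel_vector (mx_val t) ltC.
have e0 i : i \in input M :|: output M -> e i = 0.
  by move=> iIO; apply: eIO; rewrite inE negbK.
have [eps eps_inj d_neq0] := nonvanishing_line e.
pose d m i := 1 + eps m * e i.
have [i0 i0I] := set0Pn _ (input_neq0 M).
apply: (@infinite_set_of_inj _ _ (fun m => conj_param t (d m))).
  move=> m m' eqd; apply: eps_inj.
  have /(_ i1) : d m =1 d m'.
    apply: (conj_param_inj (i0 := i0) wc t_neq0 (d_neq0 m) (d_neq0 m') _ eqd).
    by rewrite /d e0 ?inE ?i0I // !mulr0.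
  by move/addrI/(mulIf ei1).
move=> m /=; apply: (coef_map_conj (d := d m) (d_neq0 m)).
  by move=> i iIO; rewrite /d e0 // mulr0 addr0.
apply: mx_val_conj (d_neq0 m) _ => l lL.
(* (d A)_l is the column sum of A, as (e A)_l = 0, and it is 0 without leak *)
under eq_bigr => i _ do rewrite mulrDl mul1r -mulrA.
rewrite big_split /= -mulr_sumr eL ?inE // mulr0 addr0.
rewrite (bigD1 l) //= mx_valE eqxx leak_val0 // oppr0 add0r.
rewrite (bigD1 l) //= edge_val_diag add0r addrC.
apply/eqP; rewrite subr_eq0; apply/eqP; apply: eq_bigr => k kl.
by rewrite mx_valE (negPf kl).
Qed.
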